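(* Let $m,a,b>0$ be real numbers and let $k\ge 1$ be an integer with $b>k$. If $\beta=1$ and $c=1$, then the factorial moment of order $k$ of $\mathcal{GNB\text{-}BE}(m,\beta,a,b,c)$ reduces to $$\mu_{[k]}=\frac{m_{(k)}\,a_{(k)}}{(b-1)(b-2)\cdots(b-k)},$$ which is the factorial moment of order $k$ of the generalized Waring distribution.
   Context: For $r,s>0$, $B(r,s)=\frac{\Gamma(r)\Gamma(s)}{\Gamma(r+s)}$. For $u>0$ and integer $s\ge 0$, $u_{(s)}=\frac{\Gamma(u+s)}{\Gamma(u)}$. For real $y$ and integer $x\ge 0$, $\binom{y}{x}=\frac{y(y-1)\cdots(y-x+1)}{x!}$. The generalized negative binomial distribution $\mathcal{GNB}(m,\beta,\theta)$ has probability mass function $\frac{m}{m+\beta x}\binom{m+\beta x}{x}(1-\theta)^{x}\theta^{m+\beta x-x}$, $x=0,1,2,\dots$. The beta exponential distribution $\mathcal{BE}(a,b,c)$, $a,b,c>0$, has density $g(\lambda;a,b,c)=\frac{c}{B(a,b)}e^{-bc\lambda}(1-e^{-c\lambda})^{a-1}$ for $\lambda>0$. The distribution $\mathcal{GNB\text{-}BE}(m,\beta,a,b,c)$ is the mixture defined by $X\mid\lambda\sim\mathcal{GNB}(m,\beta,\theta=e^{-\lambda})$, $\lambda\sim\mathcal{BE}(a,b,c)$: its mass function is $$p(x)=\int_0^\infty \frac{m}{m+\beta x}\binom{m+\beta x}{x}(1-e^{-\lambda})^{x}e^{-\lambda(m+\beta x-x)}\,g(\lambda;a,b,c)\,d\lambda,\qquad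 x=0,1,2,\dots$$ The generalized Waring distribution with parameters $m,a,b>0$ has mass function $\frac{\Gamma(a+b)\Gamma(m+b)a_{(x)}m_{(x)}}{\Gamma(b)\Gamma(m+a+b)(m+a+b)_{(x)}}\frac{1}{x!}$, $x=0,1,2,\dots$. The factorial moment of order $k$ is $\mu_{[k]}=E[X(X-1)\cdots(X-k+1)]$. *)

(* Defs.v *)
From HB Require Import structures.
From mathcomp Require Import all_boot all_order all_algebra.
From mathcomp Require Import all_classical all_reals all_analysis.

Set Implicit Arguments.
Unset Strict Implicit.
Unset Printing Implicit Defensive.

Import Order.TTheory GRing.Theory Num.Theory.
Import numFieldNormedType.Exports.

Local Open Scope classical_set_scope.
Local Open Scope ring_scope.

Section special_functions.
Context {R : realType}.
Implicit Types (r s t u y : R) (n : nat).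

Definition gamma_fun s : R :=
  \int[@lebesgue_measure R]_(t in `]0, +oo[) (t `^ (s - 1) * expR (- t)).

(* [beta_fun] of MathComp-Analysis only takes natural-number arguments. *)
Definition real_beta_fun r s : R :=
  gamma_fun r * gamma_fun s / gamma_fun (r + s).

Definition rising u n : R := gamma_fun (u + n%:R) / gamma_fun u.

Definition falling y n : R := \prod_(i < n) (y - i%:R).

Definition gbinomial y n : R := falling y n / n`!%:R.

End special_functions.

Section distributions.
Context {R : realType}.
Implicit Types (m beta theta a b c lambda : R) (x : nat).

Definition gnb_pmf m beta theta x : R :=
  m / (m + beta * x%:R) * gbinomial (m + beta * x%:R) x
  * (1 - theta) ^+ x * theta `^ (m + beta * x%:R - x%:R).

(* Density on lambda > 0; it is only ever integrated over that half-line. *)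
Definition be_pdf a b c lambda : R :=
  c / real_beta_fun a b * expR (- (b * c * lambda))
  * (1 - expR (- (c * lambda))) `^ (a - 1).

Definition gnbbe_pmf m beta a b c x : R :=
  \int[@lebesgue_measure R]_(lambda in `]0, +oo[)
    (gnb_pmf m beta (expR (- lambda)) x * be_pdf a b c lambda).

Definition gwaring_pmf m a b x : R :=
  gamma_fun (a + b) * gamma_fun (m + b) * rising a x * rising m x
  / (gamma_fun b * gamma_fun (m + a + b) * rising (m + a + b) x)
  * (1 / x`!%:R).

End distributions.

Section random_variables.
Context {d : measure_display} {T : measurableType d} {R : realType}.
Variables (P : probability T R) (X : {RV P >-> nat}).

Definition has_pmf (p : nat -> R) : Prop :=
  forall x : nat, distribution P X [set x] = (p x)%:E.

Definition factorial_moment (k : nat) : \bar R :=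
  'E_P[fun w => falling (X w)%:R k].

End random_variables.

(* Main.v *)
Require Import Defs.
From HB Require Import structures.
From mathcomp Require Import all_boot all_order all_algebra.
From mathcomp Require Import all_classical all_reals all_analysis.
From mathcomp Require Import measurable_realfun ring lra.

Set Implicit Arguments.
Unset Strict Implicit.
Unset Printing Implicit Defensive.

Import Order.TTheory GRing.Theory Num.Theory.
Import numFieldNormedType.Exports.

Local Open Scope classical_set_scope.
Local Open Scope ring_scope.

(** Both distributions satisfy the two-term recurrence
    [(x + 1) (m + a + b + x) p (x + 1) = (a + x) (m + x) p x],
    and a probability mass function with that recurrence has the factorial
    moments claimed.  The induction on [k] starts from the total mass [1], which
    is given, so no hypergeometric series has to be summed.

    Moments.  Let [M_k N] be the sum of [falling x k * p x] over [x < N].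
    Multiplying the recurrence by [falling x k] and summing by parts gives
    [(a + k) (m + k) M_k N - (b - k - 1) M_(k+1) N = T N], where the boundary
    term [T N = (N + m + a + b - 1) falling N (k + 1) p N] is nonnegative.  When
    [b > k + 1], this bounds [M_(k+1)] by [M_k], so the series of order
    [k + 1] converges.  Hence [T] converges too, and its limit is zero:
    otherwise the terms of that convergent series would be of the order of
    [1 / N].  In the limit the moment of order [k + 1] is the one of order [k]
    multiplied by [(a + k) (m + k) / (b - k - 1)] (lemmas [waring_telescope]
    and [series_falling_cvg]).

    Recurrences.  For the generalized Waring distribution the recurrence is
    [Gamma (s + 1) = s Gamma s].  For the mixture, with [beta = c = 1], the
    mass at [x] is an elementary coefficient times [J (m + b) (a + x)], where
    [J q p] is the integral over [x > 0] of
    [exp (- q x) (1 - exp (- x)) ^ (p - 1)],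
    that is, the beta integral after the substitution [t = exp (- x)].
    Integrating the derivative of [exp (- q x) (1 - exp (- x)) ^ p] gives
    [p J (q + 1) p = q J q (p + 1)], and [J q p = J (q + 1) p + J q (p + 1)]
    holds under the integral sign; together they yield
    [(q + p) J q (p + 1) = p J q p].

    The integrands may be singular at [0] and live on a half-line, so every
    integration by parts goes through [ge0_FTC2_0y], which equates two integrals
    of nonnegative functions in the extended reals and therefore asks for no
    integrability beforehand.  Finiteness of [J] and of the Gamma integral comes
    afterwards, by comparison for some arguments and by the recurrences for the
    others. *)

(** * Falling factorials and the moments of a recurrence *)

Lemma falling0 (R : realType) (y : R) : falling y 0 = 1.
Proof. exact: big_ord0. Qed.

Lemma fallingSr (R : realType) (y : R) k :
  falling y k.+1 = falling y k * (y - k%:R).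
Proof. exact: big_ord_recr. Qed.

Lemma fallingSl (R : realType) (y : R) k :
  falling (y + 1) k.+1 = (y + 1) * falling y k.
Proof.
rewrite /falling big_ord_recl subr0; congr (_ * _); apply: eq_bigr => i _.
by rewrite lift0 -addrA -natr1; ring.
Qed.

Lemma falling_0S (R : realType) k : falling (0%:R : R) k.+1 = 0.
Proof. by rewrite /falling big_ord_recl subrr mul0r. Qed.

Lemma falling_nat_ge0 (R : realType) n k : 0 <= falling (n%:R : R) k.
Proof.
elim: k n => [|k IHk] [|n]; rewrite ?falling0 ?ler01//.
  by rewrite falling_0S.
by rewrite -natr1 fallingSl mulr_ge0// natr1 ler0n.
Qed.

(** If [l] were positive, [u n] would eventually be at least a constant multiple
    of [1 / (n + 1)], and the harmonic series would converge. *)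
Lemma limit_mul_index_summable (R : realType) (u : R ^nat) (c l : R) :
  (forall n, 0 <= u n) -> cvgn (series u) ->
  (forall n, 0 <= (n%:R + c) * u n) ->
  (n%:R + c) * u n @[n --> \oo] --> l -> l = 0.
Proof.
move=> u0 cu cu0 ul; have l0 : 0 <= l.
  rewrite -(cvg_lim _ ul)//; apply: limr_ge; last exact: nearW.
  by apply/cvg_ex; exists l.
apply: contrapT => /eqP lneq0.
have lgt0 : 0 < l by rewrite lt_neqAle eq_sym lneq0.
have [N _ HN] : \forall n \near \oo, l / 2 <= (n%:R + c) * u n.
  by apply: (cvgr_ge _ ul); lra.
(* From [l / 2 <= (n + c) u n] and [n + c <= (1 + `|c|) (n + 1)]. *)
pose K := 2 / l * (1 + `|c|).
have harmonic_le n : (N <= n)%N -> harmonic n <= K * u n.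
  move=> /HN/= lu; rewrite -[leLHS]mul1r ler_pdivrMr ?ltr0Sn// /K.
  have -> : 2 / l * (1 + `|c|) * u n * n.+1%:R =
    2 / l * ((1 + `|c|) * n.+1%:R * u n) by ring.
  rewrite mulrC -ler_pdivrMr ?divr_gt0// invf_div mul1r.
  apply: (le_trans lu); apply: ler_wpM2r => //.
  have := ler_norm c; have : 0 <= `|c| * n%:R by rewrite mulr_ge0.
  rewrite [(1 + _) * _]mulrC -natr1; lra.
pose h : R ^nat := fun n => if (n < N)%N then 0 else harmonic n.
apply: (@dvg_harmonic R).
have : cvgn (series h).
  apply: (@series_le_cvg _ h (K *: u)).
  - by move=> n; rewrite /h; case: ifP => // _; exact: harmonic_ge0.
  - by move=> n; rewrite /K mulr_ge0// mulr_ge0 ?divr_ge0 ?addr_ge0.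
  - move=> n; rewrite /h; case: ltnP => [_|/harmonic_le//].
    by rewrite mulr_ge0// mulr_ge0 ?divr_ge0 ?addr_ge0.
  - exact: is_cvg_seriesZ.
rewrite -(@is_cvg_series_restrict N R R^o h).
rewrite -(@is_cvg_series_restrict N R R^o harmonic).
suff -> : [sequence \sum_(N <= k < n) h k]_n =
    [sequence \sum_(N <= k < n) harmonic k]_n by [].
apply/funext => n; apply: eq_big_nat => i /andP[Ni _].
by rewrite /h ltnNge Ni.
Qed.

Definition waring_recurrence (R : realType) (m a b : R) (p : R ^nat) :=
  forall x, (x%:R + 1) * (m + a + b + x%:R) * p x.+1 =
            (a + x%:R) * (m + x%:R) * p x.

Section factorial_moments.
Context {R : realType} (m a b : R) (p : R ^nat).
Hypotheses (m_gt0 : 0 < m) (a_gt0 : 0 < a) (b_gt0 : 0 < b).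
Hypothesis p_ge0 : forall x, 0 <= p x.
Hypothesis p_rec : waring_recurrence m a b p.

Let fp k : R ^nat := fun x => falling x%:R k * p x.

(** Summation by parts of the recurrence against [falling x k], by induction on
    [N]: with [y = N - k] the step is
    [(a + N) (m + N) = (a + k) (m + k) + y (a + m + k + N)]. *)
Lemma waring_telescope k N :
  (a + k%:R) * (m + k%:R) * series (fp k) N
  - (b - k.+1%:R) * series (fp k.+1) N =
  (N%:R + (m + a + b - 1)) * fp k.+1 N.
Proof.
rewrite /series/=; elim: N => [|N IHN].
  by rewrite !big_geq// /fp falling_0S; ring.
rewrite !big_nat_recr//= /fp.
rewrite -[in RHS](natr1 N) fallingSl.
have -> : (N%:R + 1 + (m + a + b - 1)) *
    ((N%:R + 1) * falling N%:R k * p N.+1) =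
  falling N%:R k * ((N%:R + 1) * (m + a + b + N%:R) * p N.+1) by ring.
rewrite p_rec.
move: IHN; rewrite {3}/fp fallingSr /fp -natr1 => IHN.
lra.
Qed.

(** The nonnegative right-hand side of [waring_telescope] bounds the partial
    sums of order [k + 1] by those of order [k]; once these converge it
    converges as well, and its limit vanishes by [limit_mul_index_summable]. *)
Lemma series_falling_cvg (k : nat) :
  series p n @[n --> \oo] --> (1 : R) -> k%:R < b ->
  series (fp k) n @[n --> \oo] -->
  \prod_(i < k) ((a + i%:R) * (m + i%:R) / (b - i.+1%:R)).
Proof.
move=> p1; elim: k => [|k IHk] kb.
  rewrite big_ord0; suff -> : fp 0 = p by [].
  by apply/funext => x; rewrite /fp falling0 mul1r.
have {IHk} := IHk (lt_trans _ kb); rewrite ltr_nat ltnSn => /(_ erefl).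
rewrite big_ord_recr/=; set s := \prod_(i < k) _ => cs.
have fp_ge0 j x : 0 <= fp j x by rewrite mulr_ge0// falling_nat_ge0.
have bk : 0 < b - k.+1%:R by rewrite subr_gt0.
have ak : 0 < a + k%:R by rewrite ltr_wpDr.
have mk : 0 < m + k%:R by rewrite ltr_wpDr.
have ndS j : nondecreasing_seq (series (fp j)).
  by apply: nondecreasing_series => x _ _.
have T_ge0 N : 0 <= (N%:R + (m + a + b - 1)) * fp k.+1 N.
  case: N => [|N]; first by rewrite /fp falling_0S mul0r mulr0.
  rewrite mulr_ge0// -natr1.
  by move: (ler0n R N) m_gt0 a_gt0 b_gt0; lra.
have c1 : cvgn (series (fp k.+1)).
  apply: nondecreasing_is_cvgn => //.
  exists ((a + k%:R) * (m + k%:R) * s / (b - k.+1%:R)) => _ [N _ <-].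
  rewrite ler_pdivlMr// mulrC -subr_ge0.
  apply: le_trans (T_ge0 N) _; rewrite -waring_telescope lerD2r.
  rewrite ler_wpM2l ?mulr_ge0 ?(ltW ak) ?(ltW mk)//.
  have <- := cvg_lim _ cs => //.
  apply: nondecreasing_cvgn_le => //; apply/cvg_ex; by exists s.
move/cvg_ex : (c1) => [/= l cl].
have T_cvg : (n%:R + (m + a + b - 1)) * fp k.+1 n @[n --> \oo] -->
    (a + k%:R) * (m + k%:R) * s - (b - k.+1%:R) * l.
  under eq_fun do rewrite -waring_telescope.
  by apply: cvgB; apply: cvgM => //; exact: cvg_cst.
have /eqP := limit_mul_index_summable (fp_ge0 k.+1) c1 T_ge0 T_cvg.
rewrite subr_eq0 => /eqP E.
suff -> : s * ((a + k%:R) * (m + k%:R) / (b - k.+1%:R)) = l by [].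
rewrite mulrC mulrAC E; field; lra.
Qed.
End factorial_moments.

(** * Random variables with a given mass function on the naturals *)

Section pmf.
Context {d : measure_display} {T : measurableType d} {R : realType}.
Variables (P : probability T R) (X : {RV P >-> nat}) (p : R ^nat).
Hypothesis Xp : has_pmf X p.

Lemma has_pmf_ge0 x : 0 <= p x.
Proof. by rewrite -lee_fin -Xp. Qed.

Lemma ge0_expectation_nat (f : R ^nat) : (forall x, 0 <= f x) ->
  ('E_P[f \o X] = \sum_(0 <= x <oo) (f x * p x)%:E)%E.
Proof.
move=> f0; rewrite unlock.
rewrite -(@ge0_integral_distribution _ _ _ _ _ _ X (EFin \o f))//=.
have -> : [set: nat] = \bigcup_x [set x].
  by apply/seteqP; split => // x _; exists x.
rewrite ge0_integral_bigcup//=.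
- apply: eq_eseriesr => x _.
  rewrite (eq_integral (cst (f x)%:E)); last by move=> y; rewrite inE => ->.
  by rewrite integral_cst//= Xp EFinM.
- by move=> x _; rewrite lee_fin.
- by move=> i j _ _ [x [-> ->]].
Qed.

(** Ties the extended-real expectation to convergence of the real partial sums,
    in which the summation by parts is carried out. *)
Lemma expectation_cvg (f : R ^nat) (l : R) : (forall x, 0 <= f x) ->
  series (fun x => f x * p x) n @[n --> \oo] --> l -> ('E_P[f \o X] = l%:E)%E.
Proof.
move=> f0 fl; rewrite ge0_expectation_nat//; apply/cvg_lim => //.
rewrite (_ : (fun n => _) = EFin \o series (fun x => f x * p x)).
  by apply: cvg_EFin => //; exact: nearW.
by apply/funext => n; rewrite /= sumEFin.
Qed.

Lemma has_pmf_sum1 : series p n @[n --> \oo] --> (1 : R).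
Proof.
have E1 : ('E_P[cst 1%R \o X] = 1)%E by exact: expectation_cst.
have : (\sum_(0 <= x <oo) (p x)%:E = 1)%E.
  rewrite -E1 ge0_expectation_nat//.
  by apply: eq_eseriesr => x _; rewrite mul1r.
move=> s1; have cp : cvgn (series p).
  by apply: nnseries_is_cvg has_pmf_ge0 _; rewrite s1 ltry.
move/cvg_ex : (cp) => [l cl].
suff <- : l = 1 by [].
apply: EFin_inj; rewrite -s1; apply/esym/cvg_lim => //.
rewrite (_ : (fun n => _) = EFin \o series p).
  by apply: cvg_EFin => //; exact: nearW.
by apply/funext => n; rewrite /= sumEFin.
Qed.
End pmf.

(** The closed form depends on the mass function only through its recurrence, so
    it applies to both distributions. *)
Lemma waring_factorial_moment d (T : measurableType d) (R : realType)
    (P : probability T R) (X : {RV P >-> nat}) (p : R ^nat) (m a b : R) k :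
  0 < m -> 0 < a -> 0 < b -> k%:R < b ->
  has_pmf X p -> waring_recurrence m a b p ->
  factorial_moment X k =
    (\prod_(i < k) ((a + i%:R) * (m + i%:R) / (b - i.+1%:R)))%:E.
Proof.
move=> m0 a0 b0 kb Xp prec.
apply: (expectation_cvg (f := fun x : nat => falling (x%:R : R) k) Xp).
  by move=> x; exact: falling_nat_ge0.
apply: series_falling_cvg kb => //; first exact: has_pmf_ge0 Xp.
exact: has_pmf_sum1 Xp.
Qed.

(** * Fundamental theorem of calculus on the open half-line *)

(** Exhaustion of the open half-line by compact intervals on which the
    fundamental theorem of calculus applies; starting at [2] makes each of them
    nondegenerate. *)
Lemma itv0y_bigcup (R : realType) :
  `]0, +oo[%classic = \bigcup_n `[(n.+2%:R : R)^-1, n.+2%:R]%classic.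
Proof.
apply/seteqP; split => x /=; last first.
  by move=> [n _ /=]; rewrite !in_itv/= andbT => /andP[+ _]; exact: lt_le_trans.
rewrite in_itv/= andbT => x0.
pose n := maxn (Num.truncn x) (Num.truncn x^-1).
exists n => //=; rewrite in_itv/=; apply/andP; split.
  rewrite invf_ple ?posrE//; apply/ltW/(lt_le_trans (truncnS_gt _)).
  by rewrite ler_nat ltnS leqW// leq_maxr.
apply/ltW/(lt_le_trans (truncnS_gt _)).
by rewrite ler_nat ltnS leqW// leq_maxl.
Qed.

Section FTC2_0y.
Context {R : realType}.
Notation mu := (@lebesgue_measure R).

Lemma ge0_cvg_integral_0y (f : R -> R) :
  (forall x : R, 0 < x -> 0 <= f x) ->
  (forall x : R, 0 < x -> {for x, continuous f}) ->
  (\int[mu]_(x in `[n.+2%:R^-1%R, n.+2%:R]) (f x)%:E @[n --> \oo] -->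
   \int[mu]_(x in `]0%R, +oo[) (f x)%:E)%E.
Proof.
move=> f0 cf; rewrite itv0y_bigcup.
have pos n (x : R) : x \in `[(n.+2%:R : R)^-1, n.+2%:R] -> 0 < x.
  by rewrite in_itv/= => /andP[+ _]; apply: lt_le_trans.
apply: ge0_nondecreasing_set_cvg_integral => //.
- move=> i j ij; rewrite subsetEset; apply: subset_itv; rewrite bnd_simp.
    by rewrite lef_pV2 ?posrE// ler_nat !ltnS.
  by rewrite ler_nat !ltnS.
- move=> i; apply/measurable_EFinP.
  apply: subspace_continuous_measurable_fun => //.
  by apply: continuous_in_subspaceT => x; rewrite inE => /pos/cf.
- by move=> i x /= /pos/f0; rewrite lee_fin.
Qed.

(** Integrating [F' = u - v] over the half-line, with [u] and [v] kept apart: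
    on each compact interval both integrals are finite and the identity is
    the fundamental theorem of calculus; monotone convergence then passes to
    the limit on each side separately, whether or not the integrals are
    finite there. *)
Lemma ge0_FTC2_0y (F u v : R -> R) (l0 l1 : R) :
  (forall x : R, 0 < x -> 0 <= u x) ->
  (forall x : R, 0 < x -> {for x, continuous u}) ->
  (forall x : R, 0 < x -> 0 <= v x) ->
  (forall x : R, 0 < x -> {for x, continuous v}) ->
  (forall x : R, 0 < x -> is_derive x 1 F (u x - v x)) ->
  F x @[x --> 0^'+] --> l0 -> F x @[x --> +oo] --> l1 ->
  (\int[mu]_(x in `]0%R, +oo[) (u x)%:E + l0%:E =
   \int[mu]_(x in `]0%R, +oo[) (v x)%:E + l1%:E)%E.
Proof.
move=> u0 cu v0 cv dF Fl0 Fl1.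
pose A n := `[(n.+2%:R : R)^-1, n.+2%:R].
have pos n (x : R) : x \in A n -> 0 < x.
  by rewrite in_itv/= => /andP[+ _]; apply: lt_le_trans.
have within (f : R -> R) n : (forall x : R, 0 < x -> {for x, continuous f}) ->
    {within [set` A n], continuous f}.
  by move=> cf; apply: continuous_in_subspaceT => x; rewrite inE => /pos/cf.
have intg (f : R -> R) n : (forall x : R, 0 < x -> {for x, continuous f}) ->
    mu.-integrable [set` A n] (EFin \o f).
  move=> cf; apply: continuous_compact_integrable; first exact: segment_compact.
  exact: within.
have cF x : 0 < x -> {for x, continuous F}.
  move=> /dF[dFx _].
  exact/differentiable_continuous/derivable1_diffP.
have compact_case n :
    (\int[mu]_(x in [set` A n]) (u x)%:E + (F (n.+2%:R^-1)%R)%:E =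
     \int[mu]_(x in [set` A n]) (v x)%:E + (F n.+2%:R)%:E)%E.
  have lt_n : (n.+2%:R : R)^-1 < n.+2%:R.
    by rewrite (@lt_trans _ _ 1)// ?invf_lt1 ?ltr1n.
  have ftc := @continuous_FTC2 R (u \- v) F _ _ lt_n.
  have {}ftc : (\int[mu]_(x in [set` A n]) ((u \- v) x)%:E =
      (F n.+2%:R)%:E - (F (n.+2%:R^-1)%R)%:E)%E.
    apply: ftc.
    - apply: within => x x0; apply: cvgB; [exact: cu|exact: cv].
    - split; first by move=> x /subset_itv_oo_cc/pos/dF[].
      + apply: cvg_at_right_filter; apply: cF.
        by rewrite invr_gt0.
      + by apply: cvg_at_left_filter; apply: cF.
    - by move=> x /subset_itv_oo_cc/pos/dF[_ Dx]; rewrite derive1E Dx.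
  move: ftc.
  have -> : (\int[mu]_(x in [set` A n]) ((u \- v) x)%:E =
      \int[mu]_(x in [set` A n]) (u x)%:E -
      \int[mu]_(x in [set` A n]) (v x)%:E)%E.
    by rewrite -integralB_EFin//; exact: intg.
  rewrite -(fineK (integrable_fin_num _ (intg u n cu)))//.
  rewrite -(fineK (integrable_fin_num _ (intg v n cv)))//.
  rewrite -EFinB -EFinB -EFinD -EFinD.
  by move=> [E]; congr EFin; lra.
have fin_lim (f : R -> R) (l : R) (x_ : R ^nat) : f (x_ n) @[n --> \oo] --> l ->
    ((f (x_ n))%:E @[n --> \oo] --> l%:E)%E.
  by move=> fl; apply: cvg_EFin => //; exact: nearW.
have cvg0 : F (n.+2%:R^-1) @[n --> \oo] --> l0.
  move/cvg_at_rightP : Fl0; apply; split; first by move=> n; rewrite invr_gt0.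
  rewrite (@cvg_shiftS R^o harmonic).
  exact: cvg_harmonic.
have cvgy : F (n.+2%:R) @[n --> \oo] --> l1.
  move/cvg_pinftyP : Fl1; apply.
  rewrite (@cvg_shiftS R^o (fun n => n.+1%:R)).
  rewrite (@cvg_shiftS R^o (fun n => n%:R)).
  exact: cvgr_idn.
have def_fin (x : \bar R) (l : R) : (x +? l%:E)%E by exact: fin_num_adde_defl.
have lhs := @cvgeD _ _ eventually_filter _ _ _ _ _ (def_fin _ _)
  (ge0_cvg_integral_0y u0 cu) (fin_lim _ _ _ cvg0).
have rhs := @cvgeD _ _ eventually_filter _ _ _ _ _ (def_fin _ _)
  (ge0_cvg_integral_0y v0 cv) (fin_lim _ _ _ cvgy).
move/cvg_lim : rhs => <- //; move/cvg_lim : lhs => <- //.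
by congr (limn _); apply/funext => n; exact: compact_case.
Qed.
End FTC2_0y.

(** * Beta and Gamma integrals *)

Section beta_gamma_integrals.
Context {R : realType}.
Implicit Types (p q s t x : R).
Notation mu := (@lebesgue_measure R).

(** Integrand of the beta function [B (q, p)] after the substitution
    [t = exp (- x)], which is the form in which the mixture produces it. *)
Definition beta_kernel q p x : R :=
  expR (- (q * x)) * (1 - expR (- x)) `^ (p - 1).
Definition gamma_kernel s x : R := x `^ (s - 1) * expR (- x).

(** The integral [J q p] of the comments.  It is extended-real because its
    recurrences come first and serve to prove it finite. *)
Definition beta_integral q p : \bar R :=
  (\int[mu]_(x in `]0%R, +oo[) (beta_kernel q p x)%:E)%E.
Definition gamma_integral s : \bar R :=
  (\int[mu]_(x in `]0%R, +oo[) (gamma_kernel s x)%:E)%E.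

Lemma oneBexpRN_gt0 x : 0 < x -> 0 < 1 - expR (- x).
Proof. by move=> x0; rewrite subr_gt0 expR_lt1 oppr_lt0. Qed.

Lemma oneBexpRN_le x : 1 - expR (- x) <= x.
Proof. by have := expR_ge1Dx (- x); lra. Qed.

Lemma beta_kernel_ge0 q p x : 0 <= beta_kernel q p x.
Proof. by rewrite mulr_ge0 ?expR_ge0 ?powR_ge0. Qed.

Lemma gamma_kernel_ge0 s x : 0 <= gamma_kernel s x.
Proof. by rewrite mulr_ge0 ?expR_ge0 ?powR_ge0. Qed.

Lemma is_derive_expRN q x :
  is_derive x 1 (fun y => expR (- (q * y))) (- q * expR (- (q * x))).
Proof.
have -> : (fun y => expR (- (q * y))) = expR \o (fun y => (- q) * y).
  by apply/funext => y /=; rewrite mulNr.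
have dl : is_derive x (1:R) (fun y => (- q) * y) (- q).
  have -> : (fun y => (- q) * y) = (- q) *: (@id R) by [].
  by apply: is_derive_eq; rewrite /GRing.scale/= mulr1.
have := @is_derive1_comp R expR _ x _ _ (is_derive_expR _) dl.
by rewrite /GRing.scale/= -mulNr mulrC.
Qed.

Lemma is_derive_expRN1 x :
  is_derive x 1 (fun y => expR (- y)) (- expR (- x)).
Proof.
have := is_derive_expRN 1 x; rewrite mul1r mulN1r.
by under [X in is_derive _ _ X]eq_fun do rewrite mul1r.
Qed.

Lemma is_derive_beta q p x : 0 < x ->
  is_derive x 1 (fun y => expR (- (q * y)) * (1 - expR (- y)) `^ p)
    (p * beta_kernel (q + 1) p x - q * beta_kernel q (p + 1) x).
Proof.
move=> x0.
have d1 := is_derive_expRN q x.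
have d2 : is_derive x (1:R) (fun y => 1 - expR (- y)) (expR (- x)).
  have := is_deriveB (is_derive_cst (1 : R) x (1 : R)) (is_derive_expRN1 x).
  by rewrite sub0r opprK.
have d3 := @is_derive1_comp R (@powR R ^~ p) _ x _ _
  (@is_derive1_powR R p _ (oneBexpRN_gt0 x0)) d2.
have := is_deriveM d1 d3 => dM; apply: (is_derive_eq dM).
rewrite /GRing.scale/= /beta_kernel addrK mulrDl mul1r opprD expRD.
ring.
Qed.

Lemma is_derive_gamma s x : 0 < x ->
  is_derive x 1 (fun y => y `^ s * expR (- y))
    (s * gamma_kernel s x - gamma_kernel (s + 1) x).
Proof.
move=> x0; have d1 := @is_derive1_powR R s x x0.
have := is_deriveM d1 (is_derive_expRN1 x) => dM; apply: (is_derive_eq dM).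
rewrite /GRing.scale/= /gamma_kernel addrK.
ring.
Qed.
End beta_gamma_integrals.

Section beta_gamma_recurrences.
Context {R : realType}.
Implicit Types (p q s t x : R).
Notation mu := (@lebesgue_measure R).

Lemma is_derive_continuous (f : R -> R) x df :
  is_derive x 1 f df -> {for x, continuous f}.
Proof. by move=> [dfx _]; exact/differentiable_continuous/derivable1_diffP. Qed.

Lemma beta_kernel_continuous q p x :
  0 < x -> {for x, continuous (beta_kernel q p)}.
Proof. by move/(is_derive_beta q (p - 1))/is_derive_continuous. Qed.

Lemma gamma_kernel_continuous s x :
  0 < x -> {for x, continuous (gamma_kernel s)}.
Proof. by move/(is_derive_gamma (s - 1))/is_derive_continuous. Qed.

Lemma measurable_fun_0y (f : R -> R) :
  (forall x, 0 < x -> {for x, continuous f}) ->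
  measurable_fun (`]0, +oo[%classic : set R) (EFin \o f).
Proof.
move=> cf; apply/measurable_EFinP; apply: open_continuous_measurable_fun => //.
by move=> x; rewrite inE/= in_itv/= andbT => /cf.
Qed.

Definition measurable_beta_kernel q p :=
  measurable_fun_0y (@beta_kernel_continuous q p).
Definition measurable_gamma_kernel s :=
  measurable_fun_0y (@gamma_kernel_continuous s).

Lemma cvg0_dominated (F : set_system R) {FF : Filter F} (f g : R -> R) :
  (\forall x \near F, 0 <= f x <= g x) -> g x @[x --> F] --> 0 ->
  f x @[x --> F] --> 0.
Proof. by move=> fg g0; apply: (squeeze_cvgr fg) => //; exact: cvg_cst. Qed.

Lemma expRN_cvgy q : 0 < q -> expR (- (q * x)) @[x --> +oo] --> 0.
Proof.
move=> q0.
apply: (@cvg_comp _ _ _ (fun x => q * x) (fun y => expR (- y)) _ +oo).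
  by apply: gt0_cvgMry => //; exact: cvg_id.
exact: cvgr_expR.
Qed.

(** Raising [x / (2 s) <= exp (x / (2 s))] to the power [s] gives
    [x ^ s <= (2 s) ^ s * exp (x / 2)], hence a bound by a multiple of
    [exp (- x / 2)]. *)
Lemma powR_mul_expRN_cvgy s : 0 < s -> x `^ s * expR (- x) @[x --> +oo] --> 0.
Proof.
move=> s0; pose C := (2 * s) `^ s.
have C0 : C * expR (- (2^-1 * x)) @[x --> +oo] --> 0.
  rewrite -[X in _ --> X](mulr0 C); apply: cvgM; first exact: cvg_cst.
  exact: expRN_cvgy.
apply: cvg0_dominated C0; near=> x.
have x0 : 0 < x by near: x; exact: nbhs_pinfty_gt.
rewrite mulr_ge0 ?powR_ge0 ?expR_ge0//=.
have -> : - x = 2^-1 * x + - x + - (2^-1 * x) by ring.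
rewrite expRD mulrA ler_wpM2r ?expR_ge0//.
have -> : 2^-1 * x + - x = - (x / (2 * s) * s) by field; rewrite gt_eqF.
rewrite expRN ler_pdivrMr ?expR_gt0// expRM.
have xs0 : 0 <= x / (2 * s) by rewrite divr_ge0 ?mulr_ge0// ltW.
rewrite -powRM ?expR_ge0 ?mulr_ge0 ?(ltW s0)//.
apply: ge0_ler_powR => //; first exact: ltW.
  by rewrite nnegrE ltW.
  by rewrite nnegrE mulr_ge0 ?expR_ge0// mulr_ge0// ltW.
rewrite mulrC -ler_pdivrMr ?mulr_gt0//.
by have := expR_ge1Dx (x / (2 * s)); lra.
Unshelve. all: by end_near. Qed.

Lemma oneBexpRN_powR_le1 p x : 0 < p -> 0 < x -> (1 - expR (- x)) `^ p <= 1.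
Proof.
move=> p0 x0; have : (1 - expR (- x)) `^ p <= 1 `^ p.
  apply: ge0_ler_powR; rewrite ?nnegrE ?(ltW p0)//.
    exact/ltW/oneBexpRN_gt0.
by rewrite powR1.
Qed.

Lemma beta_integralZl c q p : 0 <= c ->
  (\int[mu]_(x in `]0%R, +oo[) (c * beta_kernel q p x)%:E =
   c%:E * beta_integral q p)%E.
Proof.
move=> c0; under eq_integral do rewrite EFinM.
apply: ge0_integralZl_EFin => //.
  by move=> x _; rewrite lee_fin beta_kernel_ge0.
exact: measurable_beta_kernel.
Qed.

(** The derivative of [exp (- q x) (1 - exp (- x)) ^ p] integrates to zero,
    since this function vanishes at both ends: it is at most [x ^ p] and at
    most [exp (- q x)]. *)
Lemma beta_integral_recurrence q p : 0 < q -> 0 < p ->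
  (p%:E * beta_integral (q + 1) p = q%:E * beta_integral q (p + 1))%E.
Proof.
move=> q0 p0.
rewrite -(beta_integralZl _ _ (ltW q0)) -(beta_integralZl _ _ (ltW p0)).
rewrite -[LHS]adde0 -[RHS]adde0.
have kc c q' p' x :
    0 < x -> {for x, continuous (fun y => c * beta_kernel q' p' y)}.
  by move=> x0; apply: cvgM; [exact: cvg_cst|exact: beta_kernel_continuous].
have k0 c q' p' x : 0 < c -> 0 <= c * beta_kernel q' p' x.
  by move=> c0; rewrite mulr_ge0 ?beta_kernel_ge0// ltW.
have F0 x : 0 < x -> 0 <= expR (- (q * x)) * (1 - expR (- x)) `^ p.
  by move=> x0; rewrite mulr_ge0 ?expR_ge0 ?powR_ge0.
apply: (ge0_FTC2_0y _ _ _ _ (fun x => @is_derive_beta R q p x)).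
- by move=> x _; exact: k0.
- by move=> x; exact: kc.
- by move=> x _; exact: k0.
- by move=> x; exact: kc.
- apply: cvg0_dominated (powR_cvg0 p0); near=> x.
  have x0 : 0 < x by [].
  rewrite F0//= -[leRHS]mul1r ler_pM ?expR_ge0 ?powR_ge0//.
    by rewrite expR_le1 oppr_le0 mulr_ge0 ?ltW.
  have z0 := ltW (oneBexpRN_gt0 x0).
  apply: ge0_ler_powR; rewrite ?nnegrE ?(ltW p0) ?(ltW x0) ?z0//.
  exact: oneBexpRN_le.
- apply: cvg0_dominated (expRN_cvgy q0); near=> x.
  have x0 : 0 < x by near: x; exact: nbhs_pinfty_gt.
  by rewrite F0//= -[leRHS]mulr1 ler_wpM2l ?expR_ge0// oneBexpRN_powR_le1.
Unshelve. all: by end_near. Qed.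

(** [1 = exp (- x) + (1 - exp (- x))] under the integral sign. *)
Lemma beta_integral_split q p :
  beta_integral q p = (beta_integral (q + 1) p + beta_integral q (p + 1))%E.
Proof.
rewrite /beta_integral -ge0_integralD//; try
  by [move=> x _; rewrite lee_fin beta_kernel_ge0
     | exact: measurable_beta_kernel].
apply: eq_integral => x; rewrite inE/= in_itv/= andbT => x0.
rewrite -EFinD; congr EFin; rewrite /beta_kernel.
have z0 := oneBexpRN_gt0 x0.
have -> : (1 - expR (- x)) `^ (p + 1 - 1) =
    (1 - expR (- x)) `^ (p - 1) * (1 - expR (- x)).
  rewrite -[X in _ * X](powRr1 (ltW z0)) -powRD ?(gt_eqF z0) ?implybT//.
  by congr (_ `^ _); ring.
rewrite mulrDl mul1r opprD expRD; ring.
Qed.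

Lemma beta_integral_ge0 q p : (0 <= beta_integral q p)%E.
Proof. by apply: integral_ge0 => x _; rewrite lee_fin beta_kernel_ge0. Qed.

Lemma gamma_integral_ge0 s : (0 <= gamma_integral s)%E.
Proof. by apply: integral_ge0 => x _; rewrite lee_fin gamma_kernel_ge0. Qed.

Lemma beta_integral1 q : 0 < q -> beta_integral q 1 = (q^-1)%:E.
Proof.
move=> q0.
have kE x : beta_kernel q 1 x = expR (- (q * x)).
  by rewrite /beta_kernel subrr powRr0 mulr1.
have dF x : is_derive x 1 (fun y => - q^-1 * expR (- (q * y)))
    (beta_kernel q 1 x - 0).
  have := is_deriveZ (- q^-1) (is_derive_expRN q x) => dZ.
  apply: (is_derive_eq dZ); rewrite kE subr0 /GRing.scale/=.
  by field; rewrite gt_eqF.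
have F0 : - q^-1 * expR (- (q * x)) @[x --> 0^'+] --> - q^-1.
  have := cvg_at_right_filter (is_derive_continuous (dF 0)).
  by rewrite mulr0 oppr0 expR0 mulr1.
have Fy : - q^-1 * expR (- (q * x)) @[x --> +oo] --> 0.
  rewrite -[X in _ --> X](mulr0 (- q^-1)); apply: cvgM; first exact: cvg_cst.
  exact: expRN_cvgy.
have E : (beta_integral q 1 + (- q^-1)%:E = 0)%E.
  rewrite /beta_integral.
  rewrite (ge0_FTC2_0y (v := cst 0) _ _ _ _ (fun x _ => dF x) F0 Fy).
  - by rewrite integral0 adde0.
  - by move=> x _; exact: beta_kernel_ge0.
  - by move=> x; exact: beta_kernel_continuous.
  - by [].
  - by move=> x _; exact: cvg_cst.
by case: (beta_integral q 1) E => [r [E]||]//; congr EFin; lra.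
Qed.

(** [J q (p + 1) <= J q 1 = 1 / q], since the power of [1 - exp (- x)] is at
    most [1]; the recurrence transfers finiteness to [J (q + 1) p], singular
    at [0] when [p < 1], and [J q p] is the sum of the two. *)
Lemma beta_integral_fin q p : 0 < q -> 0 < p -> beta_integral q p \is a fin_num.
Proof.
move=> q0 p0; have finS : beta_integral q (p + 1) \is a fin_num.
  rewrite ge0_fin_numE ?beta_integral_ge0//.
  apply: (@le_lt_trans _ _ (beta_integral q 1)).
    apply: ge0_le_integral => //; try
      by [move=> x _; rewrite lee_fin beta_kernel_ge0
         | exact: measurable_beta_kernel].
    move=> x /=; rewrite in_itv/= andbT => x0; rewrite lee_fin /beta_kernel.
    rewrite ler_wpM2l ?expR_ge0// subrr powRr0 addrK.
    exact: oneBexpRN_powR_le1.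
  by rewrite beta_integral1// ltry.
rewrite beta_integral_split fin_numD finS andbT.
have := beta_integral_recurrence q0 p0.
case: (beta_integral (q + 1) p) (beta_integral_ge0 (q + 1) p) => [r|_|]//.
by rewrite gt0_muley ?lte_fin// -(fineK finS).
Qed.

Lemma gamma_integral_recurrence s : 0 < s ->
  gamma_integral (s + 1) = (s%:E * gamma_integral s)%E.
Proof.
move=> s0; rewrite /gamma_integral.
rewrite -ge0_integralZl_EFin ?(ltW s0)//; try
  by [move=> x _; rewrite lee_fin gamma_kernel_ge0
     | exact: measurable_gamma_kernel].
rewrite -[LHS]adde0 -[RHS]adde0; apply/esym.
have F0 x : 0 <= x `^ s * expR (- x) by rewrite mulr_ge0 ?expR_ge0 ?powR_ge0.
apply: (ge0_FTC2_0y _ _ _ _ (fun x => @is_derive_gamma R s x)).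
- by move=> x _; rewrite mulr_ge0 ?gamma_kernel_ge0// ltW.
- by move=> x x0; apply: cvgM; [exact: cvg_cst|exact: gamma_kernel_continuous].
- by move=> x _; exact: gamma_kernel_ge0.
- by move=> x; exact: gamma_kernel_continuous.
- apply: cvg0_dominated (powR_cvg0 s0); near=> x.
  have x0 : 0 < x by [].
  rewrite F0//= -[leRHS]mulr1 ler_wpM2l ?powR_ge0//.
  by rewrite expR_le1 oppr_le0 ltW.
- exact: powR_mul_expRN_cvgy.
Unshelve. all: by end_near. Qed.

(** For [s <= 1] the inequality [1 - exp (- x) <= x] bounds the Gamma kernel
    by the kernel of [J 1 s]; larger arguments follow from the recurrence. *)
Lemma gamma_integral_fin s : 0 < s -> gamma_integral s \is a fin_num.
Proof.
move=> s0; have [n sn] : exists n : nat, s <= n.+1%:R.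
  by exists (Num.truncn s); apply/ltW/truncnS_gt.
elim: n s s0 sn => [|n IHn] s s0 sn.
  rewrite ge0_fin_numE ?gamma_integral_ge0//.
  apply: (@le_lt_trans _ _ (beta_integral 1 s)); last first.
    by rewrite -ge0_fin_numE ?beta_integral_ge0// beta_integral_fin.
  apply: ge0_le_integral => //.
  + by move=> x _; rewrite lee_fin gamma_kernel_ge0.
  + exact: measurable_gamma_kernel.
  + exact: measurable_beta_kernel.
  move=> x /=; rewrite in_itv/= andbT => x0; rewrite lee_fin.
  rewrite /gamma_kernel /beta_kernel mul1r [leLHS]mulrC ler_wpM2l ?expR_ge0//.
  rewrite -(opprB 1 s) !powRN lef_pV2 ?posrE ?powR_gt0 ?oneBexpRN_gt0//.
  apply: ge0_ler_powR; rewrite ?nnegrE ?subr_ge0 ?(ltW x0)//.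
    by rewrite expR_le1 oppr_le0 ltW.
  exact: oneBexpRN_le.
have [s1|s1] := leP s 1.
  by apply: IHn => //; rewrite (le_trans s1)// ler1n.
have -> : s = (s - 1) + 1 by ring.
rewrite gamma_integral_recurrence ?subr_gt0//.
rewrite fin_numM// IHn ?subr_gt0//.
by rewrite lerBlDr natr1.
Qed.

(** By the recurrence it suffices to treat [s + 1 > 1], where the kernel is
    at least [exp (- 2)] on [[1, 2]]. *)
Lemma gamma_integral_gt0 s : 0 < s -> (0 < gamma_integral s)%E.
Proof.
move=> s0; suff : (0 < gamma_integral (s + 1))%E.
  rewrite gamma_integral_recurrence// => H.
  by rewrite -(@pmule_rgt0 _ s%:E) ?lte_fin.
apply: (@lt_le_trans _ _ (\int[mu]_(x in `[1%R, 2%R]) (expR (- 2))%:E)%E).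
  rewrite integral_cst//= lebesgue_measure_itv/= lte_fin ltr1n/=.
  by rewrite -EFinB -EFinM lte_fin mulr_gt0 ?expR_gt0//; lra.
have sub12 : `[1, 2]%classic `<=` (`]0, +oo[%classic : set R).
  by apply: subset_itv; rewrite ?bnd_simp.
apply: (@le_trans _ _
    (\int[mu]_(x in `[1%R, 2%R]) (gamma_kernel (s + 1) x)%:E)%E).
  apply: ge0_le_integral => //.
  + apply: measurable_funS sub12 (measurable_gamma_kernel (s + 1)) => //.
  + move=> x /=; rewrite in_itv/= => /andP[x1 x2]; rewrite lee_fin.
    rewrite /gamma_kernel addrK -[leLHS]mul1r ler_pM ?expR_ge0//.
      by rewrite -(powRr0 x) ler_powR// ltW.
    by rewrite ler_expR lerN2.
apply: ge0_subset_integral => //.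
  exact: measurable_gamma_kernel.
by move=> x _; rewrite lee_fin gamma_kernel_ge0.
Qed.

End beta_gamma_recurrences.

(** Eliminates [J (q + 1) p] between [beta_integral_recurrence] and
    [beta_integral_split]; the eliminated value has to be finite. *)
Lemma beta_integral_ratio (R : realType) (q p : R) : 0 < q -> 0 < p ->
  (q + p) * fine (beta_integral q (p + 1)) = p * fine (beta_integral q p).
Proof.
move=> q0 p0; have q1 : 0 < q + 1 by rewrite addr_gt0.
have p1 : 0 < p + 1 by rewrite addr_gt0.
rewrite (beta_integral_split q p); move: (beta_integral_recurrence q0 p0).
move: (beta_integral_fin q1 p0) (beta_integral_fin q0 p1).
case: (beta_integral (q + 1) p) => [J1||]//.
case: (beta_integral q (p + 1)) => [J2||]// _ _ [rec] /=.
by rewrite mulrDr rec; ring.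
Qed.

(** * Gamma function and rising factorials *)

Section gamma_fun.
Context {R : realType}.
Implicit Types s u : R.

Lemma gamma_funE s : gamma_fun s = fine (gamma_integral s).
Proof. by []. Qed.

Lemma gamma_funS s : 0 < s -> gamma_fun (s + 1) = s * gamma_fun s.
Proof.
move=> s0; rewrite !gamma_funE gamma_integral_recurrence// fineM//.
exact: gamma_integral_fin.
Qed.

Lemma gamma_fun_gt0 s : 0 < s -> 0 < gamma_fun s.
Proof.
move=> s0; rewrite gamma_funE fine_gt0// gamma_integral_gt0//=.
by rewrite -ge0_fin_numE ?gamma_integral_fin// gamma_integral_ge0.
Qed.

Lemma risingS u n : 0 < u -> rising u n.+1 = (u + n%:R) * rising u n.
Proof.
by move=> u0; rewrite /rising -natr1 addrA gamma_funS ?mulrA// ltr_wpDr.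
Qed.

Lemma rising_prod u n : 0 < u -> rising u n = \prod_(i < n) (u + i%:R).
Proof.
move=> u0; elim: n => [|n IHn]; last first.
  by rewrite risingS// IHn big_ord_recr mulrC.
by rewrite big_ord0 /rising addr0 divff// gt_eqF// gamma_fun_gt0.
Qed.
End gamma_fun.

(** * The two mass functions satisfy the recurrence *)

Section recurrences.
Context {R : realType} (m a b : R).
Hypotheses (m_gt0 : 0 < m) (a_gt0 : 0 < a) (b_gt0 : 0 < b).
Notation mu := (@lebesgue_measure R).

Lemma gwaring_recurrence : waring_recurrence m a b (gwaring_pmf m a b).
Proof.
move=> x; have mab0 : 0 < m + a + b by rewrite !addr_gt0.
have mabx : 0 < m + a + b + x%:R by rewrite ltr_wpDr.
have x1 : x%:R + 1 != 0 :> R by rewrite natr1.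
rewrite /gwaring_pmf !risingS// factS natrM -natr1.
(* Abstracting the common factors keeps the field equation small. *)
move: (rising a x) (rising m x) (rising (m + a + b) x) => ra rm r.
move: (gamma_fun b) (gamma_fun (m + a + b)) x`!%:R => gb gmab f.
move: (gamma_fun _) (gamma_fun _) => gab gmb.
rewrite !invfM; move: gb^-1 gmab^-1 r^-1 f^-1 => *.
by field; rewrite x1 gt_eqF.
Qed.

(** The [l]-independent factor of the mixture integrand, equal to
    [m (m + 1) ... (m + x - 1) / x!] divided by [B (a, b)]. *)
Definition gnbbe_coef x : R :=
  m / (m + x%:R) * gbinomial (m + x%:R) x * (1 / real_beta_fun a b).

Lemma gnbbe_coefS x : (x%:R + 1) * gnbbe_coef x.+1 = (m + x%:R) * gnbbe_coef x.
Proof.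
rewrite /gnbbe_coef /gbinomial factS natrM -natr1 addrA fallingSl.
have x1 : x%:R + 1 != 0 :> R by rewrite natr1.
have mx : 0 < m + x%:R by rewrite ltr_wpDr.
have mx1 : m + x%:R + 1 != 0 by rewrite gt_eqF// ltr_wpDr.
rewrite invfM; move: (falling _ _) (x`!%:R)^-1 (1 / _) => F f B.
by field; rewrite mx1 x1 gt_eqF.
Qed.

(** With [theta = exp (- l)] and [beta = c = 1], the powers of [theta] and of
    [1 - theta] in the two densities merge into one beta kernel. *)
Lemma gnbbe_pmfE x : gnbbe_pmf m 1 a b 1 x =
  gnbbe_coef x * fine (beta_integral (m + b) (a + x%:R)).
Proof.
have ax : 0 < a + x%:R by rewrite ltr_wpDr.
have mb : 0 < m + b by rewrite addr_gt0.
have beta_int : mu.-integrable `]0, +oo[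
    (EFin \o beta_kernel (m + b) (a + x%:R)).
  apply/integrableP; split; first exact: measurable_beta_kernel.
  under eq_integral do rewrite gee0_abs ?lee_fin ?beta_kernel_ge0//.
  by rewrite -ge0_fin_numE ?beta_integral_ge0// beta_integral_fin.
transitivity (\int[mu]_(l in `]0, +oo[)
    (gnbbe_coef x * beta_kernel (m + b) (a + x%:R) l)); last first.
  exact: RintegralZl.
apply: eq_Rintegral => l; rewrite inE/= in_itv/= andbT => l0.
rewrite /gnb_pmf /be_pdf /beta_kernel /gnbbe_coef !mul1r mulr1 addrK.
have z0 := oneBexpRN_gt0 l0.
have -> : (1 - expR (- l)) `^ (a + x%:R - 1) =
    (1 - expR (- l)) ^+ x * (1 - expR (- l)) `^ (a - 1).
  rewrite -powR_mulrn ?(ltW z0)// -powRD ?(gt_eqF z0) ?implybT//.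
  by congr (_ `^ _); ring.
have -> : expR (- ((m + b) * l)) = expR (- l) `^ m * expR (- (b * l)).
  by rewrite -expRM -expRD; congr expR; ring.
ring.
Qed.

Lemma gnbbe_recurrence : waring_recurrence m a b (gnbbe_pmf m 1 a b 1).
Proof.
move=> x; rewrite !gnbbe_pmfE -natr1 addrA.
have ax : 0 < a + x%:R by rewrite ltr_wpDr.
have mb : 0 < m + b by rewrite addr_gt0.
move: (beta_integral_ratio mb ax) (gnbbe_coefS x).
move: (fine _) (fine _) (gnbbe_coef x) (gnbbe_coef x.+1) => J J' C C' JJ' CC'.
transitivity ((x%:R + 1) * C' * ((m + b + (a + x%:R)) * J')); first by ring.
by rewrite CC' JJ'; ring.
Qed.
End recurrences.

Theorem corollary2 (R : realType) (m a b beta c : R) (k : nat)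
    (hm : 0 < m) (ha : 0 < a) (hb : 0 < b) (hk : (1 <= k)%N) (hbk : k%:R < b)
    (hbeta : beta = 1) (hc : c = 1) :
  let mu := rising m k * rising a k / \prod_(1 <= i < k.+1) (b - i%:R) in
  (forall (d : measure_display) (T : measurableType d) (P : probability T R)
      (X : {RV P >-> nat}),
    has_pmf X (gnbbe_pmf m beta a b c) -> factorial_moment X k = mu%:E) /\
  (forall (d : measure_display) (T : measurableType d) (P : probability T R)
      (Y : {RV P >-> nat}),
    has_pmf Y (gwaring_pmf m a b) -> factorial_moment Y k = mu%:E).
Proof.
have -> : rising m k * rising a k / \prod_(1 <= i < k.+1) (b - i%:R) =
    \prod_(i < k) ((a + i%:R) * (m + i%:R) / (b - i.+1%:R)).
  rewrite !rising_prod// prodf_div big_split/= mulrC big_add1 big_mkord.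
  by rewrite [in RHS]mulrC [X in _ * X]mulrC.
subst beta c; split=> d T P X Xp.
  exact: waring_factorial_moment Xp (gnbbe_recurrence hm ha hb).
exact: waring_factorial_moment Xp (gwaring_recurrence hm ha hb).
Qed.
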